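(* Suppose that $f$ is continuously differentiable on an open set $O\supseteq\operatorname{dom}\varphi$, that $\varphi$ is proper, lower semicontinuous and prox-bounded, and that $\inf F>-\infty$. Let the algorithm described in the context be run, and suppose there exists $M_B>0$ with $\|B_k\|\le M_B$ for all $k\in\mathbb{N}_0$. If $\nabla f$ is uniformly continuous on $O$, then $$\liminf_{k\in\mathcal K}\ \operatorname{dist}\bigl(0,\partial F(\hat x^k)\bigr)=0 .$$
   Context: Problem: minimize $F(x):=f(x)+\varphi(x)$ over $x\in\mathbb{R}^n$, with $f:\mathbb{R}^n\to\mathbb{R}$ and $\varphi:\mathbb{R}^n\to\overline{\mathbb{R}}:=\mathbb{R}\cup\{\infty\}$. Here $\operatorname{dom}\varphi=\{x:\varphi(x)<\infty\}$; $\varphi$ is proper if $\operatorname{dom}\varphi\ne\emptyset$; $\varphi$ is prox-bounded if there exist $\gamma>0$ and $x\in\mathbb{R}^n$ with $\inf_{y}\{\varphi(y)+\frac{1}{2\gamma}\|y-x\|^2\}>-\infty$. As a standing assumption $F$ is proper and lower semicontinuous. $\partial$ denotes the limiting (Mordukhovich) subdifferential, and $\operatorname{dist}(x,C)=\inf_{y\in C}\|x-y\|$. Algorithm: parameters $c_1\in(0,1)$, $\sigma_2>1$, $0<\mu_{\min}\le\mu_{\max}<\infty$. Start with $x^0\in\operatorname{dom}\varphi$, a symmetric matrix $B_0\in\mathbb{R}^{n\times n}$ and $\mu_0\in[\mu_{\min},\mu_{\max}]$. For $k=0,1,2,\dots$ let $$q_k(x):=f(x^k)+\nabla f(x^k)^\top(x-x^k)+\tfrac12(x-x^k)^\top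 B_k(x-x^k)+\varphi(x),\quad G_k:=B_k+\mu_kI,\quad \hat q_k(x):=q_k(x)+\tfrac{\mu_k}{2}\|x-x^k\|^2 .$$ Search for a global minimizer $\hat x^k$ of $\hat q_k$ over $\mathbb{R}^n$. If one is found, set $d^k:=\hat x^k-x^k$, $\mathrm{ared}_k:=F(x^k)-F(\hat x^k)$, $\mathrm{pred}_k:=F(x^k)-q_k(\hat x^k)$. If $\hat x^k$ is found and $\mathrm{ared}_k\ge c_1\,\mathrm{pred}_k$ (iteration $k$ is successful), set $x^{k+1}=\hat x^k$ and choose an arbitrary symmetric $B_{k+1}\in\mathbb{R}^{n\times n}$ and an arbitrary $\mu_{k+1}\in[\mu_{\min},\mu_{\max}]$. Otherwise (unsuccessful), set $x^{k+1}=x^k$, $B_{k+1}=B_k$, $\mu_{k+1}=\sigma_2\mu_k$. Standing assumption: whenever $\hat q_k$ has a minimizer, a minimizer $\hat x^k$ is found. $\mathcal K$ is the set of $k\in\mathbb{N}_0$ for which $\hat x^k$ is found. *)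

(* Defs.v *)
From HB Require Import structures.
From mathcomp Require Import all_boot all_order all_algebra.
From mathcomp Require Import all_classical all_reals all_analysis.

Set Implicit Arguments.
Unset Strict Implicit.
Unset Printing Implicit Defensive.

Import Order.TTheory GRing.Theory Num.Theory.
Import numFieldNormedType.Exports.

Local Open Scope classical_set_scope.
Local Open Scope ring_scope.

(* R^n is 'cV[R]_n.  The library norm on matrices is the sup norm: it is used
   only through the topology and the differentials it induces, which do not
   depend on the norm.  All metric quantities use the Euclidean norm enorm. *)
Section Euclidean.
Context {R : realType} {n : nat}.
Implicit Types (x y : 'cV[R]_n) (C : set 'cV[R]_n).

Definition dotv x y : R := (x^T *m y) 0 0.

Definition enorm x : R := Num.sqrt (dotv x x).

Definition opnorm (A : 'M[R]_n) : \bar R :=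
  ereal_sup [set (enorm (A *m x))%:E | x in [set x | enorm x <= 1]].

(* Equal to +oo when C is empty. *)
Definition edist_to x C : \bar R := ereal_inf [set (enorm (x - y))%:E | y in C].

(* This is the gradient wherever f is differentiable, and junk elsewhere. *)
Definition grad (f : 'cV[R]_n -> R) x : 'cV[R]_n :=
  \col_i 'd f x (delta_mx i 0 : 'cV[R]_n).

Definition C1_on (O : set 'cV[R]_n) (f : 'cV[R]_n -> R) : Prop :=
  (forall x, O x -> differentiable f x) /\ {within O, continuous (grad f)}.

Definition unif_continuous_on (O : set 'cV[R]_n) (g : 'cV[R]_n -> 'cV[R]_n) :=
  forall e : R, 0 < e -> exists2 d : R, 0 < d &
    forall x y, O x -> O y -> enorm (x - y) < d -> enorm (g x - g y) < e.

End Euclidean.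

(* A function into R U {+oo} is a map to \bar R which avoids -oo; the latter is
   a hypothesis on phi in the theorem and is not part of the predicates below. *)
Section ExtendedFunctions.
Context {R : realType} {n : nat}.
Implicit Types (g : 'cV[R]_n -> \bar R) (x y v : 'cV[R]_n).

Definition edom g : set 'cV[R]_n := [set x | (g x < +oo)%E].

Definition proper_efun g : Prop := edom g !=set0.

Definition prox_bounded g : Prop :=
  exists (gamma : R) x, 0 < gamma /\
    (-oo < ereal_inf
      [set g y + ((2 * gamma)^-1 * enorm (y - x) ^+ 2)%:E | y in setT])%E.

Definition global_minimizer g x : Prop := forall y, (g x <= g y)%E.

Definition regular_subdiff g x : set 'cV[R]_n :=
  [set v | g x \is a fin_num /\
    (0 <= limf_einf (fun y => (g y - g x - (dotv v (y - x))%:E)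
                              * ((enorm (y - x))^-1)%:E) x^')%E].

Definition limiting_subdiff g x : set 'cV[R]_n :=
  [set v | g x \is a fin_num /\
    exists (xs vs : nat -> 'cV[R]_n),
      [/\ xs @ \oo --> x, g (xs j) @[j --> \oo] --> g x, vs @ \oo --> v
        & forall j, regular_subdiff g (xs j) (vs j)]].

End ExtendedFunctions.

Section Algorithm.
Context {R : realType} {n : nat}.
Variables (f : 'cV[R]_n -> R) (phi : 'cV[R]_n -> \bar R).

Definition objective (x : 'cV[R]_n) : \bar R := ((f x)%:E + phi x)%E.

Definition model (xk : 'cV[R]_n) (Bk : 'M[R]_n) (x : 'cV[R]_n) : \bar R :=
  ((f xk + dotv (grad f xk) (x - xk)
    + 2^-1 * dotv (x - xk) (Bk *m (x - xk)))%:E + phi x)%E.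

Definition reg_model (xk : 'cV[R]_n) (Bk : 'M[R]_n) (muk : R)
    (x : 'cV[R]_n) : \bar R :=
  (model xk Bk x + (muk / 2 * enorm (x - xk) ^+ 2)%:E)%E.

Variables (c1 sigma2 mumin mumax : R).
Variables (x : nat -> 'cV[R]_n) (B : nat -> 'M[R]_n) (mu : nat -> R).
(* K is the set of iterations at which a minimizer is found; xhat k is
   meaningful only for k in K. *)
Variables (K : set nat) (xhat : nat -> 'cV[R]_n).

Definition ared (k : nat) : \bar R :=
  (objective (x k) - objective (xhat k))%E.

Definition pred_red (k : nat) : \bar R :=
  (objective (x k) - model (x k) (B k) (xhat k))%E.

Definition successful (k : nat) : Prop :=
  K k /\ (c1%:E * pred_red k <= ared k)%E.

Record algorithm_run : Prop := AlgorithmRun {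
  run_x0 : edom phi (x 0);
  run_B0 : (B 0)^T = B 0;
  run_mu0 : mumin <= mu 0 <= mumax;
  run_xhat : forall k, K k ->
    global_minimizer (reg_model (x k) (B k) (mu k)) (xhat k);
  run_successful : forall k, successful k ->
    [/\ x k.+1 = xhat k, (B k.+1)^T = B k.+1 & mumin <= mu k.+1 <= mumax];
  run_unsuccessful : forall k, ~ successful k ->
    [/\ x k.+1 = x k, B k.+1 = B k & mu k.+1 = sigma2 * mu k]
}.

Definition minimizers_found : Prop :=
  forall k, (exists z, global_minimizer (reg_model (x k) (B k) (mu k)) z) ->
    K k.

End Algorithm.

(* Main.v *)
Require Import Defs.
From HB Require Import structures.
From mathcomp Require Import all_boot all_order all_algebra.
From mathcomp Require Import all_classical all_reals all_analysis.
From mathcomp Require Import ring lra.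

Import Order.TTheory GRing.Theory Num.Theory.
Import numFieldNormedType.Exports.

Local Open Scope classical_set_scope.
Local Open Scope ring_scope.

(** Write [d k] for [xhat k - x k].  Fermat's rule for the regularized model
    puts [grad f (xhat k) - grad f (x k) - (B k + mu k I) (d k)] in the
    subdifferential of [F] at the trial point [xhat k], so the stationarity
    measure is at most
    [|grad f (xhat k) - grad f (x k)| + (MB + mu k) |d k|] ([edist_trial_le]).

    Suppose that this measure stays above some [eps > 0] at all late [k] in
    [K].  The sufficient decrease makes [mu k |d k|^2] summable over the
    successful iterations; hence [d k] tends to 0 along them, the gradient
    difference becomes negligible by uniform continuity, and [mu k |d k|] is
    eventually at least [eps / 4].  The decrease of [F] then controls
    [|d k|] itself and not only its square ([step_le_decrease]), so the iterates
    form a Cauchy sequence.  Their limit [p] lies in [dom phi], because [F] is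
    lower semicontinuous, and so a ball around [p] lies in [O].  This
    localization is what makes the mean value theorem available although [O]
    need not be convex.

    Unsuccessful iterations with arbitrarily large [mu k] occur arbitrarily late
    ([unsuccessful_large_mu]): otherwise [mu] would be bounded, whereas either
    all late iterations fail and [mu] grows geometrically, or successes recur
    and [mu k |d k| >= eps / 4] with [d k] tending to 0.  When [mu k] is large,
    prox-boundedness yields a minimizer of the regularized model, so that [k] is
    in [K], and forces [d k] to be small ([large_mu_step_small]).  Failure of the
    acceptance test says that the error of the quadratic model of [f] is at
    least [(1 - c1) (mu k / 2) |d k|^2], while by the mean value theorem near
    [p] it is at most a small multiple of [|d k|] plus [MB / 2 |d k|^2].  Hence
    [mu k |d k|] is small, and so is the stationarity measure, a
    contradiction ([not_nonstationary]). *)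

(** * Euclidean norm *)

Section EuclideanNorm.
Context {R : realType} {n : nat}.
Implicit Types (x y z : 'cV[R]_n) (a : R).

Lemma dotvE x y : dotv x y = \sum_i x i 0 * y i 0.
Proof. by rewrite /dotv mxE; apply: eq_bigr => i _; rewrite mxE. Qed.

Lemma dotvC x y : dotv x y = dotv y x.
Proof. by rewrite !dotvE; apply: eq_bigr => i _; rewrite mulrC. Qed.

Lemma dotvDl x y z : dotv (x + y) z = dotv x z + dotv y z.
Proof. by rewrite /dotv linearD mulmxDl mxE. Qed.

Lemma dotvDr x y z : dotv x (y + z) = dotv x y + dotv x z.
Proof. by rewrite /dotv mulmxDr mxE. Qed.

Lemma dotvZl a x y : dotv (a *: x) y = a * dotv x y.
Proof. by rewrite /dotv linearZ /= -scalemxAl mxE. Qed.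

Lemma dotvZr a x y : dotv x (a *: y) = a * dotv x y.
Proof. by rewrite dotvC dotvZl dotvC. Qed.

Lemma dotvNl x y : dotv (- x) y = - dotv x y.
Proof. by rewrite -scaleN1r dotvZl mulN1r. Qed.

Lemma dotvNr x y : dotv x (- y) = - dotv x y.
Proof. by rewrite dotvC dotvNl dotvC. Qed.

Lemma dotvBl x y z : dotv (x - y) z = dotv x z - dotv y z.
Proof. by rewrite dotvDl dotvNl. Qed.

Lemma dotvBr x y z : dotv x (y - z) = dotv x y - dotv x z.
Proof. by rewrite dotvDr dotvNr. Qed.

Lemma dotv_mulmx_sym (A : 'M[R]_n) x y :
  A^T = A -> dotv x (A *m y) = dotv y (A *m x).
Proof.
move=> AT; rewrite /dotv mulmxA -{1}AT -trmx_mul; exact: dotvC.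
Qed.

Lemma dotv_ge0 x : 0 <= dotv x x.
Proof. by rewrite dotvE sumr_ge0 // => i _; rewrite -expr2 sqr_ge0. Qed.

Lemma enorm_ge0 x : 0 <= enorm x.
Proof. exact: sqrtr_ge0. Qed.

Lemma enorm_sqr x : enorm x ^+ 2 = dotv x x.
Proof. by rewrite sqr_sqrtr ?dotv_ge0. Qed.

Lemma enormZ a x : enorm (a *: x) = `|a| * enorm x.
Proof.
by rewrite /enorm dotvZl dotvZr mulrA -expr2 sqrtrM ?sqr_ge0 // sqrtr_sqr.
Qed.

Lemma enormN x : enorm (- x) = enorm x.
Proof. by rewrite -scaleN1r enormZ normrN1 mul1r. Qed.

Lemma enorm0 : enorm (0 : 'cV[R]_n) = 0.
Proof. by rewrite -(scale0r 0) enormZ normr0 mul0r. Qed.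

Lemma enorm_distC x y : enorm (x - y) = enorm (y - x).
Proof. by rewrite -enormN opprB. Qed.

Lemma dotv_eq0 x : dotv x x = 0 -> x = 0.
Proof.
rewrite dotvE => /eqP; rewrite psumr_eq0; last first.
  by move=> i _; rewrite -expr2 sqr_ge0.
move=> /allP x0; apply/matrixP => i j; rewrite ord1 mxE.
by have := x0 i (mem_index_enum i); rewrite /= mulf_eq0 orbb => /eqP.
Qed.

Lemma enorm_eq0 x : enorm x = 0 -> x = 0.
Proof. by move=> x0; apply: dotv_eq0; rewrite -enorm_sqr x0 expr0n. Qed.

(** Cauchy-Schwarz inequality. *)
Lemma ler_dotv x y : dotv x y <= enorm x * enorm y.
Proof.
have [x0|xn0] := eqVneq (enorm x) 0.
  by rewrite (enorm_eq0 _ x0) enorm0 mul0r -(scale0r 0) dotvZl mul0r.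
have [y0|yn0] := eqVneq (enorm y) 0.
  by rewrite (enorm_eq0 _ y0) enorm0 mulr0 -(scale0r 0) dotvZr mul0r.
have x_gt0 : 0 < enorm x by rewrite lt_def xn0 enorm_ge0.
have y_gt0 : 0 < enorm y by rewrite lt_def yn0 enorm_ge0.
have := dotv_ge0 (enorm y *: x - enorm x *: y).
rewrite !(dotvBl, dotvBr, dotvZl, dotvZr) -!enorm_sqr (dotvC y x).
rewrite [X in 0 <= X](_ : _ =
  2 * (enorm x * enorm y) * (enorm x * enorm y - dotv x y)); last by ring.
by rewrite pmulr_rge0 ?subr_ge0 // !mulr_gt0.
Qed.

Lemma ler_norm_dotv x y : `|dotv x y| <= enorm x * enorm y.
Proof. by rewrite ler_norml lerNl -dotvNl -{1}(enormN x) !ler_dotv. Qed.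

Lemma enormD x y : enorm (x + y) <= enorm x + enorm y.
Proof.
rewrite -(@ler_pXn2r _ 2) ?nnegrE ?addr_ge0 ?enorm_ge0 //.
rewrite enorm_sqr dotvDl !dotvDr (dotvC y x) sqrrD !enorm_sqr.
have := ler_dotv x y; lra.
Qed.

Lemma enorm_triangle z x y : enorm (x - y) <= enorm (x - z) + enorm (z - y).
Proof. by rewrite -(subrKA z) enormD. Qed.

Lemma enorm_sqrD_le x y : enorm (x + y) ^+ 2 <= 2 * enorm x ^+ 2 + 2 * enorm y ^+ 2.
Proof.
rewrite !enorm_sqr dotvDl !dotvDr (dotvC y x).
have := dotv_ge0 (x - y); rewrite dotvBl !dotvBr (dotvC y x); lra.
Qed.

Lemma ler_coord_enorm x i : `|x i 0| <= enorm x.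
Proof.
rewrite -sqrtr_sqr ler_wsqrtr // dotvE (bigD1 i) //= -expr2 lerDl.
by rewrite sumr_ge0 // => j _; rewrite -expr2 sqr_ge0.
Qed.

Lemma ler_norm_enorm x : `|x| <= enorm x.
Proof.
rewrite [leLHS]/Num.norm /= mx_normrE; apply/bigmax_leP; split.
  exact: enorm_ge0.
by case=> i j _ /=; rewrite ord1 ler_coord_enorm.
Qed.

Lemma ler_enorm_norm x : enorm x <= n%:R * `|x|.
Proof.
rewrite -(@ler_pXn2r _ 2) ?nnegrE ?mulr_ge0 ?enorm_ge0 // enorm_sqr dotvE.
apply: (@le_trans _ _ (\sum_(i < n) `|x| ^+ 2)).
  apply: ler_sum => i _; rewrite -expr2 -real_normK ?num_real //.
  rewrite ler_pXn2r ?nnegrE //.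
  rewrite [leRHS]/Num.norm /= mx_normrE; apply/bigmax_geP; right => /=.
  by exists (i, 0).
rewrite sumr_const card_ord -[leLHS]mulr_natl exprMn ler_wpM2r ?sqr_ge0 //.
rewrite -natrX ler_nat; case: (n) => // m; rewrite expnS expn1.
by rewrite leq_pmulr.
Qed.

(** The Euclidean norm induces the topology of the space of columns. *)
Lemma nbhs_enormP x (A : set 'cV[R]_n) :
  nbhs x A <-> exists2 e, 0 < e & forall y, enorm (y - x) < e -> A y.
Proof.
split=> [/nbhs_ballP[e /= e0 eA]|[e e0 eA]].
  exists e => // y yx; apply: eA; rewrite mx_norm_ball /ball_ /=.
  by rewrite distrC (le_lt_trans (ler_norm_enorm _)).
(* Dividing by [n.+1] rather than [n] covers the case [n = 0]. *)
apply/nbhs_ballP; exists (e / n.+1%:R) => /=; first by rewrite divr_gt0.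
move=> y; rewrite mx_norm_ball /ball_ /= => yx.
apply: eA; apply: le_lt_trans (ler_enorm_norm _) _.
rewrite ltr_pdivlMr // distrC in yx.
by apply: le_lt_trans yx; rewrite mulrC ler_wpM2l // ler_nat.
Qed.

Lemma ler_enorm_mulmx (A : 'M[R]_n) a x :
  0 <= a -> (opnorm A <= a%:E)%E -> enorm (A *m x) <= a * enorm x.
Proof.
move=> a0 Aa; have [x0|xn0] := eqVneq (enorm x) 0.
  by rewrite (enorm_eq0 _ x0) mulmx0 enorm0 mulr0.
have x_gt0 : 0 < enorm x by rewrite lt_def xn0 enorm_ge0.
rewrite -ler_pdivrMr // -lee_fin; apply: le_trans Aa; apply: ereal_sup_ubound.
exists ((enorm x)^-1 *: x) => /=.
  by rewrite enormZ ger0_norm ?invr_ge0 ?enorm_ge0 // mulVf.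
by rewrite -scalemxAr enormZ ger0_norm ?invr_ge0 ?enorm_ge0 // mulrC.
Qed.

(** Bolzano-Weierstrass: a bounded sequence has a cluster point. *)
Lemma bounded_seq_cluster (u : nat -> 'cV[R]_n) (r : R) :
  (forall k, enorm (u k) <= r) ->
  exists p, forall e, 0 < e -> forall N, exists2 k, (N <= k)%N &
    enorm (u k - p) < e.
Proof.
move=> ur.
(* Compactness of boxes is stated for rows, whence the transposes. *)
pose A := [set v : 'rV[R]_n | forall i, `[- r, r]%classic (v ord0 i)].
have cA : compact A.
  by apply: (@rV_compact R n (fun=> `[- r, r]%classic)) => i; exact: segment_compact.
have uA k : A (u k)^T.
  by move=> i; rewrite /= in_itv /= mxE -ler_norml (le_trans (ler_coord_enorm _ _)).
have [|q [_ qcl]] := cA ((fun k => (u k)^T) @ \oo) _.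
  by exists 0%N => // k _; exact: uA.
exists q^T => e e0 N.
have NN : ((fun k => (u k)^T) @ \oo) [set (u k)^T | k in [set k | (N <= k)%N]].
  by exists N => // k Nk; exists k.
have [] := qcl _ (ball q (e / n.+1%:R)) NN.
  by apply: nbhsx_ballx; rewrite divr_gt0.
move=> _ [[k Nk <-]]; rewrite mx_norm_ball /ball_ /= => qe; exists k => //.
rewrite enorm_distC; apply: le_lt_trans (ler_enorm_norm _) _.
have -> : `|q^T - u k| = `|q - (u k)^T|.
  rewrite /Num.norm /= !mx_normrE; apply/le_anti/andP; split; apply/bigmax_leP; split;
    rewrite ?bigmax_ge_id //; case=> i j _ /=; apply/bigmax_geP; right;
    by exists (j, i); rewrite //= !mxE.
rewrite ltr_pdivlMr // in qe.
by apply: le_lt_trans qe; rewrite mulrC ler_wpM2l // ler_nat.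
Qed.

End EuclideanNorm.

(** * Differentiation along segments and Taylor expansion *)

Section Differentiation.
Context {R : realType} {n : nat}.
Implicit Types (f : 'cV[R]_n -> R) (x h : 'cV[R]_n).

Lemma diff_grad f x h : differentiable f x -> 'd f x h = dotv (grad f x) h.
Proof.
move=> df; rewrite {1}(matrix_sum_delta h) linear_sum dotvE.
apply: eq_bigr => i _; rewrite linear_sum big_ord1 linearZ /= /grad mxE.
by rewrite -[_ *: _]/(_ * _) mulrC.
Qed.

(** First order Taylor expansion, in the Euclidean norm. *)
Lemma differentiable_expansion f x (e : R) : differentiable f x -> 0 < e ->
  exists2 d, 0 < d & forall y, enorm (y - x) < d ->
    `|f y - f x - dotv (grad f x) (y - x)| <= e * enorm (y - x).
Proof.
move=> df e0.
have /eqaddoP /(_ e e0) : f \o shift x = (cst (f x) + 'd f x) +o_ (0 : 'cV[R]_n) id.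
  exact: diff_locally.
move=> /nbhs_enormP[d d0 dP]; exists d => // y yx.
have /dP : enorm (y - x - 0) < d by rewrite subr0.
rewrite !fctE /= subrK diff_grad // opprD addrA => /le_trans; apply.
by rewrite (ler_wpM2l (ltW e0)) // ler_norm_enorm.
Qed.

Lemma differentiable_continuous_enorm f x (e : R) : differentiable f x -> 0 < e ->
  exists2 d, 0 < d & forall y, enorm (y - x) < d -> `|f y - f x| < e.
Proof.
move=> df e0; have /differentiable_continuous fx := df.
have /cvgrPdist_lt /(_ e e0) : f y @[y --> x] --> f x := fx.
by move=> /nbhs_enormP[d d0 dP]; exists d => // y /dP; rewrite distrC.
Qed.

Lemma is_derive_segment f x h (t : R) : differentiable f (x + t *: h) ->
  is_derive t 1 (fun s => f (x + s *: h)) (dotv (grad f (x + t *: h)) h).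
Proof.
move=> df.
have fE : (fun s => s^-1 *:
    ((f \o shift (x + t *: h)) (s *: h) - f (x + t *: h))) =
  (fun s => s^-1 *: (((fun s => f (x + s *: h)) \o shift t) (s *: (1 : R)) -
     f (x + t *: h))).
  apply/funext => s /=; congr (_ *: (f _ - _)).
  by rewrite -[s *: 1]/(s * 1) mulr1 scalerDl addrCA.
apply: DeriveDef.
  by have := @diff_derivable _ _ _ _ _ h df; rewrite /derivable fE.
by rewrite -diff_grad // -deriveE // /derive fE.
Qed.

(** Mean value theorem on the segment from [x] to [x + h]. *)
Lemma segment_MVT f x h :
  (forall t : R, 0 <= t <= 1 -> differentiable f (x + t *: h)) ->
  exists2 t : R, 0 <= t <= 1 & f (x + h) - f x = dotv (grad f (x + t *: h)) h.
Proof.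
move=> df; have [|||t t01] := @MVT_segment R (fun s => f (x + s *: h))
  (fun t => dotv (grad f (x + t *: h)) h) 0 1.
- exact: ler01.
- move=> t; rewrite in_itv /= => /andP[t0 t1]; apply: is_derive_segment.
  by apply: df; rewrite !ltW.
- apply: derivable_within_continuous => t; rewrite in_itv /= => /df.
  by move=> /is_derive_segment[].
rewrite scale1r scale0r addr0 subr0 mulr1 => ->.
by exists t => //; move: t01; rewrite in_itv.
Qed.

End Differentiation.

(** * Subdifferentials and the regularized model *)

Section Subdifferential.
Context {R : realType} {n : nat}.
Implicit Types (g phi : 'cV[R]_n -> \bar R) (f : 'cV[R]_n -> R).
Implicit Types (x y v : 'cV[R]_n) (B : 'M[R]_n).

(** A first order minorant of [g] at [x] gives a regular subgradient; there
    [g y] may be infinite. *)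
Lemma mem_regular_subdiff g x v : g x \is a fin_num ->
  (forall e : R, 0 < e -> exists2 d : R, 0 < d & forall y, enorm (y - x) < d ->
     (g x + (dotv v (y - x) - e * enorm (y - x))%:E <= g y)%E) ->
  regular_subdiff g x v.
Proof.
move=> gx lb; split=> //; rewrite limf_einfE; apply/lee_addgt0Pr => e e0.
have [d d0 dP] := lb e e0.
rewrite -leeBlDr // sub0e -EFinN.
set V := [set y | enorm (y - x) < d /\ y != x].
apply: le_trans (ereal_sup_ubound _); last first.
  exists V; last by [].
  by apply/nbhs_enormP; exists d => // y yd yx; split.
apply: le_ereal_inf_tmp => _ [y [yd yx] <-].
have yx0 : 0 < enorm (y - x).
  rewrite lt_def enorm_ge0 andbT; apply: contra yx => /eqP /enorm_eq0 /eqP.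
  by rewrite subr_eq0.
have := dP y yd; move: gx; case: (g x) => [gx| |] // _.
case: (g y) => [gy| |] //; last first.
  by move=> _; rewrite /= gt0_mulye ?leey // lte_fin invr_gt0.
rewrite -EFinD lee_fin => gxy.
by rewrite -!EFinB -EFinM lee_fin ler_pdivlMr //; lra.
Qed.

Lemma regular_sub_limiting_subdiff g x v :
  regular_subdiff g x v -> limiting_subdiff g x v.
Proof.
move=> gxv; split; first by case: gxv.
by exists (fun=> x), (fun=> v); split => //; exact: cvg_cst.
Qed.

Lemma edist_to_ge0 x (C : set 'cV[R]_n) : (0 <= edist_to x C)%E.
Proof.
by apply: le_ereal_inf_tmp => _ [y _ <-]; rewrite lee_fin enorm_ge0.
Qed.

Lemma edist_to0_le (C : set 'cV[R]_n) v : C v -> (edist_to 0 C <= (enorm v)%:E)%E.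
Proof.
by move=> Cv; apply: ereal_inf_lbound; exists v => //=; rewrite sub0r enormN.
Qed.

(** The finite part of the regularized model: the model is the sum of this
    quadratic polynomial and of [phi]. *)
Definition quad_model f x B (mu : R) y : R :=
  f x + dotv (grad f x) (y - x) + 2^-1 * dotv (y - x) (B *m (y - x))
    + mu / 2 * enorm (y - x) ^+ 2.

Lemma reg_modelE f phi x B mu y :
  reg_model f phi x B mu y = ((quad_model f x B mu y)%:E + phi y)%E.
Proof. by rewrite /reg_model /model addeAC -EFinD. Qed.

Lemma quad_model_center f x B mu : quad_model f x B mu x = f x.
Proof.
by rewrite /quad_model subrr mulmx0 enorm0 -(scale0r 0) !dotvZr expr0n /=; ring.
Qed.

(** Second order expansion of the quadratic model around an arbitrary [y]. *)
Lemma quad_model_expansion f x B mu y z : B^T = B ->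
  quad_model f x B mu z = quad_model f x B mu y
    + dotv (grad f x + (B *m (y - x) + mu *: (y - x))) (z - y)
    + 2^-1 * dotv (z - y) (B *m (z - y)) + mu / 2 * enorm (z - y) ^+ 2.
Proof.
move=> BT; rewrite /quad_model.
have -> : z - x = (z - y) + (y - x) by rewrite subrKA.
move: (z - y) (y - x) => h d.
rewrite !enorm_sqr mulmxDr !(dotvDl, dotvDr, dotvZl) (dotv_mulmx_sym _ d h BT).
rewrite (dotvC d h) (dotvC (B *m d) h); lra.
Qed.

Lemma ler_norm_dotv_mulmx B (b : R) y : 0 <= b -> (opnorm B <= b%:E)%E ->
  `|dotv y (B *m y)| <= b * enorm y ^+ 2.
Proof.
move=> b0 Bb; apply: le_trans (ler_norm_dotv _ _) _.
rewrite expr2 mulrA (mulrC b) -mulrA ler_wpM2l ?enorm_ge0 //.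
exact: ler_enorm_mulmx.
Qed.

(** Fermat's rule for the regularized model, transferred to the objective. *)
Lemma minimizer_regular_subdiff f phi x B (mu b : R) y :
  B^T = B -> 0 <= b -> (opnorm B <= b%:E)%E -> 0 <= mu ->
  (forall z, phi z != -oo%E) -> phi y \is a fin_num -> differentiable f y ->
  global_minimizer (reg_model f phi x B mu) y ->
  regular_subdiff (objective f phi) y
    (grad f y - grad f x - (B *m (y - x) + mu *: (y - x))).
Proof.
move=> BT b0 Bb mu0 phiNy phiy dfy ymin; apply: mem_regular_subdiff.
  by rewrite /objective fin_numD phiy.
move=> e e0; have e20 : 0 < e / 2 by rewrite divr_gt0.
have [d1 d10 d1P] := differentiable_expansion _ _ _ dfy e20.
exists (Num.min d1 (e / (b + mu + 1))).
  by rewrite lt_min d10 divr_gt0 //; lra.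
move=> z; rewrite lt_min => /andP[/d1P zd1 zd2].
have := ymin z; rewrite !reg_modelE /objective.
move: phiy (phiNy z); case: (phi y) => [py| |] // _; case: (phi z) => [pz| |] // _.
  rewrite -!EFinD !lee_fin (quad_model_expansion _ _ _ _ y z BT) => le_yz.
  have := ler_norm_dotv_mulmx _ _ (z - y) b0 Bb.
  rewrite !ler_norml in zd1 * => /andP[_ Bzy]; case/andP: zd1 => zd1 _.
  rewrite ltr_pdivlMr in zd2; last by lra.
  have := enorm_ge0 (z - y); move: (enorm (z - y)) => t in zd1 zd2 Bzy le_yz * => t0.
  have tt : t * (b + mu) * t <= e * t by rewrite ler_wpM2r //; lra.
  have arith (q g1 g2 w g3 fz fy : R) :
      q + py <= q + (g1 + g2) + 2^-1 * w + mu / 2 * t ^+ 2 + pz ->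
      - (e / 2 * t) <= fz - fy - g3 -> w <= b * t ^+ 2 ->
      fy + py + (g3 - g1 - g2 - e * t) <= fz + pz.
    by clear -tt; lra.
  by rewrite !dotvBl; rewrite dotvDl in le_yz; exact: arith le_yz zd1 Bzy.
by move=> _; rewrite addey ?leey // -EFinD.
Qed.

(** Prox-boundedness is the existence of a concave quadratic minorant. *)
Lemma prox_bounded_minorant phi : prox_bounded phi ->
  exists (a c : R) xbar, 0 <= a /\
    forall y, ((c - a * enorm (y - xbar) ^+ 2)%:E <= phi y)%E.
Proof.
move=> [gamma [xbar [gamma0 infNy]]].
have [c cP] : exists c : R, (c%:E <= ereal_inf
  [set phi y + ((2 * gamma)^-1 * enorm (y - xbar) ^+ 2)%:E | y in setT])%E.
  case: (ereal_inf _) infNy => [r| |] // _; first by exists r.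
  by exists 0; rewrite leey.
exists (2 * gamma)^-1, c, xbar; split.
  by rewrite invr_ge0 mulr_ge0 // ltW.
move=> y; rewrite EFinB leeBlDr //; apply: le_trans cP _.
by apply: ereal_inf_lbound; exists y.
Qed.

(** The regularized model is minorized by a quadratic function of the distance
    to its center [x], convex as soon as [mu] is large; the bound
    [|y - xbar|^2 <= 2 |y - x|^2 + 2 |x - xbar|^2] moves the center of the
    minorant of [phi] from [xbar] to [x]. *)
Lemma reg_model_minorant f phi x B (mu b a c : R) xbar y :
  0 <= b -> (opnorm B <= b%:E)%E -> 0 <= a ->
  (forall y, ((c - a * enorm (y - xbar) ^+ 2)%:E <= phi y)%E) ->
  ((f x + c - 2 * a * enorm (x - xbar) ^+ 2 - enorm (grad f x) * enorm (y - x)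
    + (mu / 2 - b / 2 - 2 * a) * enorm (y - x) ^+ 2)%:E
    <= reg_model f phi x B mu y)%E.
Proof.
move=> b0 Bb a0 /(_ y) phiy; rewrite reg_modelE.
apply: le_trans (leeD2l _ phiy); rewrite -EFinD lee_fin /quad_model.
have := ler_norm_dotv_mulmx _ _ (y - x) b0 Bb.
have := ler_norm_dotv (grad f x) (y - x).
rewrite !ler_norml => /andP[g1 _] /andP[g2 _].
have : a * enorm (y - xbar) ^+ 2 <=
    a * (2 * enorm (y - x) ^+ 2 + 2 * enorm (x - xbar) ^+ 2).
  by rewrite ler_wpM2l // -(subrKA x) enorm_sqrD_le.
by lra.
Qed.

End Subdifferential.

(** * Existence and localization of minimizers *)

Section Existence.
Context {R : realType} {n : nat}.
Implicit Types (g phi : 'cV[R]_n -> \bar R) (f s : 'cV[R]_n -> R).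

Lemma lower_semicontinuousD s phi :
  continuous s -> (forall z, phi z != -oo%E) -> lower_semicontinuous phi ->
  lower_semicontinuous (fun y => (s y)%:E + phi y)%E.
Proof.
move=> sc phiNy lphi p a ap.
have [e e0 eP] : exists2 e : R, 0 < e & ((a - s p + e)%:E < phi p)%E.
  move: (phiNy p) ap; case: (phi p) => [r| |] // _; last by exists 1; rewrite ?ltey.
  rewrite -EFinD lte_fin => ar; exists ((s p + r - a) / 2); first by lra.
  by rewrite lte_fin; lra.
have [V pV VP] := lphi p _ eP.
have sp : \forall y \near p, `|s p - s y| < e.
  by have /cvgrPdist_lt /(_ e e0) := sc p.
exists (V `&` [set y | `|s p - s y| < e]); first exact: filterI.
move=> y [/VP + /=]; move: (phiNy y); case: (phi y) => [r| |] // _; last first.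
  by rewrite addey ?ltey.
by rewrite -EFinD !lte_fin ltr_norml => + /andP[? ?]; lra.
Qed.

(** Weierstrass' theorem: a lower semicontinuous function which is bounded
    below and has a bounded nonempty sublevel set attains its infimum. *)
Lemma lower_semicontinuous_minimizer g (x0 : 'cV[R]_n) (c r : R) :
  lower_semicontinuous g -> g x0 \is a fin_num ->
  (forall y, (c%:E <= g y)%E) ->
  (forall y, (g y <= g x0)%E -> enorm y <= r) ->
  exists y, global_minimizer g y.
Proof.
move=> lg gx0 gc gr.
have mc : (c%:E <= ereal_inf (range g))%E.
  by apply: le_ereal_inf_tmp => _ [y _ <-].
have mle y : (ereal_inf (range g) <= g y)%E by apply: ereal_inf_lbound; exists y.
have mfin : ereal_inf (range g) \is a fin_num.
  move: mc (mle x0); case: (ereal_inf _) => [?| |] //.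
  by move: gx0; case: (g x0).
case: (lem (exists y, g y = ereal_inf (range g))) => [[y gy]|nomin].
  by exists y => z; rewrite gy mle.
have mlt y : (ereal_inf (range g) < g y)%E.
  by rewrite lt_def mle andbT; apply/eqP => /esym gy; apply: nomin; exists y.
(* A minimizing sequence inside the sublevel set of [x0]. *)
have seqP (k : nat) : exists y, (g y <= g x0)%E /\
    (g y < ereal_inf (range g) + (k.+1%:R^-1)%:E)%E.
  have k0 : 0 < k.+1%:R^-1 :> R by [].
  have [_ [y _ <-] gy] := lb_ereal_inf_adherent k0 mfin.
  have [gyx|gxy] := leP (g y) (g x0); first by exists y.
  by exists x0; split => //; exact: lt_trans gxy gy.
have [u uP] := choice seqP.
have [p pP] : exists p, forall e, 0 < e -> forall N, exists2 k, (N <= k)%N &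
    enorm (u k - p) < e.
  by apply: (bounded_seq_cluster u r) => k; apply: gr; have [] := uP k.
have := mlt p; move: mfin uP; case: (ereal_inf _) => [m| |] // _ uP mp.
have [e e0 eP] : exists2 e : R, 0 < e & ((m + e)%:E < g p)%E.
  move: mp; case: (g p) => [q| |] //; last by exists 1; rewrite ?ltey.
  by rewrite lte_fin => mq; exists ((q - m) / 2); rewrite ?lte_fin; lra.
have [V /nbhs_enormP[d d0 dV] VP] := lg p _ eP.
have [N _ NP] : \forall k \near \oo, k.+1%:R^-1 < e :> R.
  exact: near_infty_natSinv_lt (PosNum e0).
have [k Nk /dV/VP guk] := pP _ d0 N.
have [_ ukg] := uP k; have := lt_trans guk ukg; rewrite -EFinD lte_fin ltrD2l => ek.
by have := lt_trans (NP k Nk) ek; rewrite ltxx.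
Qed.

Lemma quad_model_continuous f (x : 'cV[R]_n) B (mu b : R) :
  B^T = B -> 0 <= b -> (opnorm B <= b%:E)%E -> continuous (quad_model f x B mu).
Proof.
move=> BT b0 Bb y; apply/(@cvgrPdist_lt _ _ _ _ (nbhs_filter y)) => e e0.
pose v := grad f x + (B *m (y - x) + mu *: (y - x)).
pose C := enorm v + b / 2 + `|mu| / 2.
have C0 : 0 <= C by rewrite !addr_ge0 ?divr_ge0 ?enorm_ge0.
have Ce : 0 < e / (C + 1) by rewrite divr_gt0 //; lra.
apply/nbhs_enormP; exists (Num.min 1 (e / (C + 1))).
  by rewrite lt_min Ce ltr01.
move=> z; rewrite lt_min => /andP[z1 z2]; rewrite ltr_pdivlMr in z2; last by lra.
have h1 := ler_norm_dotv v (z - y).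
have h2 := ler_norm_dotv_mulmx _ _ (z - y) b0 Bb.
rewrite (quad_model_expansion _ _ _ _ y z BT) -/v distrC.
have tri (q r s w : R) : `|q + r + s + w - q| <= `|r| + (`|s| + `|w|).
  rewrite (_ : q + r + s + w - q = r + (s + w)); last by ring.
  by apply: le_trans (ler_normD _ _) _; rewrite lerD2l ler_normD.
apply: le_lt_trans (tri _ _ _ _) _.
have := enorm_ge0 (z - y); move: (enorm (z - y)) => t in z1 z2 h1 h2 * => t0.
have tt : t ^+ 2 <= t by rewrite expr2 ler_piMr // ltW.
have h3 : `|mu / 2 * t ^+ 2| <= `|mu| / 2 * t.
  by rewrite normrM normf_div (ger0_norm (sqr_ge0 _)) (gtr0_norm (ltr0n _ 2)) ler_wpM2l.
have h4 : `|2^-1 * dotv (z - y) (B *m (z - y))| <= b / 2 * t.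
  rewrite normrM gtr0_norm ?invr_gt0 // (_ : b / 2 * t = 2^-1 * (b * t)); last by ring.
  rewrite ler_wpM2l ?invr_ge0 //.
  by apply: le_trans h2 _; rewrite ler_wpM2l.
apply: le_lt_trans (lerD h1 (lerD h4 h3)) _.
by apply: le_lt_trans z2; rewrite /C; lra.
Qed.

Lemma quadratic_minorant (a L t : R) : 0 < a ->
  - (L ^+ 2 / (4 * a)) <= a * t ^+ 2 - L * t.
Proof.
move=> a0; rewrite -subr_ge0.
have -> : a * t ^+ 2 - L * t - - (L ^+ 2 / (4 * a)) = (2 * a * t - L) ^+ 2 / (4 * a).
  by field; rewrite gt_eqF.
by rewrite divr_ge0 ?sqr_ge0 //; lra.
Qed.

Lemma quadratic_le_bounded (a L D t : R) : 0 < a -> 0 <= L -> 0 <= D ->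
  a * t ^+ 2 - L * t <= D -> t <= (L + D) / a + 1.
Proof.
move=> a0 L0 D0 le_t; rewrite leNgt; apply/negP => lt_t.
have t1 : 1 < t.
  by apply: le_lt_trans lt_t; rewrite lerDr divr_ge0 ?addr_ge0 // ltW.
have : (L + D + a) * t < a * t * t.
  rewrite ltr_pM2r; last by lra.
  have : (L + D) / a < t - 1 by lra.
  by rewrite ltr_pdivrMr //; lra.
have : 0 <= D * (t - 1) by rewrite mulr_ge0 //; lra.
have : 0 < a * t by rewrite mulr_gt0 //; lra.
by move: le_t; lra.
Qed.

Lemma reg_model_has_minimizer f phi (x : 'cV[R]_n) B (mu b a c : R) xbar :
  B^T = B -> 0 <= b -> (opnorm B <= b%:E)%E -> 0 <= a ->
  (forall y, ((c - a * enorm (y - xbar) ^+ 2)%:E <= phi y)%E) ->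
  lower_semicontinuous phi -> phi x \is a fin_num ->
  b + 4 * a < mu ->
  exists y, global_minimizer (reg_model f phi x B mu) y.
Proof.
move=> BT b0 Bb a0 phiP phil phix mu_gt.
have minor y := reg_model_minorant f phi x B mu b a c xbar y b0 Bb a0 phiP.
set L := enorm (grad f x) in minor; set D := f x + c - _ in minor.
have L0 : 0 <= L by exact: enorm_ge0.
pose al := mu / 2 - b / 2 - 2 * a; have al0 : 0 < al by rewrite /al; lra.
move: phix; case phixE : (phi x) => [px| |] // _.
have rx : reg_model f phi x B mu x = (f x + px)%:E.
  by rewrite reg_modelE quad_model_center phixE.
pose E := `|f x + px - D|.
apply: (lower_semicontinuous_minimizer _ x (D - L ^+ 2 / (4 * al))
  (enorm x + ((L + E) / al + 1))).
- have -> : reg_model f phi x B mu = (fun y => (quad_model f x B mu y)%:E + phi y)%E.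
    by apply/funext => y; rewrite reg_modelE.
  apply: lower_semicontinuousD => //; first exact: quad_model_continuous BT b0 Bb.
  by move=> z; apply/eqP => phiz; have := phiP z; rewrite phiz.
- by rewrite rx.
- move=> y; apply: le_trans (minor y); rewrite lee_fin -/al.
  by have := quadratic_minorant al L (enorm (y - x)) al0; lra.
- move=> y; rewrite rx => /(le_trans (minor y)); rewrite lee_fin -/al => le_y.
  have le_E : f x + px - D <= E by exact: ler_norm.
  have := quadratic_le_bounded al L E (enorm (y - x)) al0 L0 (normr_ge0 _).
  have := enormD (y - x) x; rewrite subrK => yx.
  by move=> /(_ ltac:(lra)); lra.
Qed.

(** A quadratic bound with a large leading coefficient confines the variable
    to a small interval. *)
Lemma quadratic_le_small (A L D eta : R) : 0 < eta -> 0 <= L ->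
  exists M : R, forall mu t, M <= mu -> 0 <= t ->
    (mu / 2 - A) * t ^+ 2 - L * t <= D -> t < eta.
Proof.
move=> eta0 L0; exists (2 * (A + L / eta + `|D| / eta ^+ 2 + 1)) => mu t muM t0 le_t.
rewrite ltNge; apply/negP => eta_t.
have t2 : 0 < t ^+ 2 by rewrite exprn_gt0 // (lt_le_trans eta0).
have h1 : L * t <= L / eta * t ^+ 2.
  rewrite -mulrA ler_wpM2l // expr2 mulrA ler_peMl //.
  by rewrite mulrC ler_pdivlMr // mul1r.
have h2 : D <= `|D| / eta ^+ 2 * t ^+ 2.
  apply: le_trans (ler_norm _) _; rewrite -mulrA ler_peMr //.
  rewrite mulrC ler_pdivlMr ?exprn_gt0 // mul1r ler_pXn2r // ?nnegrE //; lra.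
have : (A + L / eta + `|D| / eta ^+ 2 + 1) * t ^+ 2 <= mu / 2 * t ^+ 2.
  by rewrite ler_wpM2r ?sqr_ge0 //; lra.
move: (L / eta) (`|D| / eta ^+ 2) h1 h2 => u w h1 h2.
move: (t ^+ 2) t2 le_t h1 h2 => T; nra.
Qed.

End Existence.

(** * Runs of the algorithm *)

(** The arithmetic behind the final contradiction. A lower bound on a model
    error [w - q / 2] of second order in the step length [t] meets an upper
    bound of first order, which makes [m * t], and with it the residual,
    small. *)
Lemma residual_lt {R : realFieldType} (c eps b m t g u w q : R) :
  0 < eps -> 0 < c -> c < 1 -> 0 <= t ->
  b * t < eps * (1 - c) / 8 -> g < eps * (1 - c) / 8 -> u < eps * (1 - c) / 8 ->
  (1 - c) * (m / 2 * t ^+ 2) <= w - 2^-1 * q -> w <= u * t ->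
  - (b * t ^+ 2) <= q ->
  g + (b + m) * t < eps.
Proof.
move=> eps0 c0 c1 t0 bt g_lt u_lt le_w le_ut le_q.
have c10 : 0 < 1 - c by rewrite subr_gt0.
have eta_le : eps * (1 - c) / 8 <= eps / 8.
  by rewrite ler_pM2r ?invr_gt0 // ler_piMr ?(ltW eps0) // gerBl ltW.
have [t_eq0|t_neq0] := eqVneq t 0; first by rewrite t_eq0 mulr0; lra.
have t_gt0 : 0 < t by rewrite lt_def t_neq0.
have : m * t < 3 * (eps / 8).
  rewrite -(@ltr_pM2l _ (1 - c)) // -(@ltr_pM2r _ t) //.
  have : b * t * t < eps * (1 - c) / 8 * t by rewrite ltr_pM2r.
  have : u * t < eps * (1 - c) / 8 * t by rewrite ltr_pM2r.
  by lra.
by lra.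
Qed.

Section AlgorithmRun.
Context {R : realType} {n : nat}.
Context (f : 'cV[R]_n -> R) (phi : 'cV[R]_n -> \bar R) (O : set 'cV[R]_n).
Context (c1 sigma2 mumin mumax : R).
Context (x : nat -> 'cV[R]_n) (B : nat -> 'M[R]_n) (mu : nat -> R).
Context (K : set nat) (xhat : nat -> 'cV[R]_n) (MB : R).
Context (phi_neqNy : forall y, phi y != -oo%E).
Context (c1_gt0 : 0 < c1) (c1_lt1 : c1 < 1) (sigma2_gt1 : 1 < sigma2).
Context (mumin_gt0 : 0 < mumin).
Context (dom_phi_O : edom phi `<=` O).
Context (f_diff : forall y, O y -> differentiable f y).
Context (run : algorithm_run f phi c1 sigma2 mumin mumax x B mu K xhat).
Context (MB_gt0 : 0 < MB) (B_bounded : forall k, (opnorm (B k) <= MB%:E)%E).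

Local Notation succ := (successful f phi c1 x B K xhat).
Local Notation d k := (xhat k - x k).

Lemma fin_num_edom y : edom phi y -> phi y \is a fin_num.
Proof. by move: (phi_neqNy y); rewrite /edom /=; case: (phi y). Qed.

Lemma edom_fin_num y : phi y \is a fin_num -> edom phi y.
Proof. by rewrite /edom /=; case: (phi y) => // r _; rewrite ltry. Qed.

Lemma step_successful k : succ k ->
  [/\ x k.+1 = xhat k, (B k.+1)^T = B k.+1 & mumin <= mu k.+1 <= mumax].
Proof. exact: run_successful run k. Qed.

Lemma step_unsuccessful k : ~ succ k ->
  [/\ x k.+1 = x k, B k.+1 = B k & mu k.+1 = sigma2 * mu k].
Proof. exact: run_unsuccessful run k. Qed.

Lemma trial_minimizer k : K k ->
  global_minimizer (reg_model f phi (x k) (B k) (mu k)) (xhat k).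
Proof. exact: run_xhat run k. Qed.

Lemma trial_fin_num k : K k -> phi (x k) \is a fin_num ->
  phi (xhat k) \is a fin_num.
Proof.
move=> Kk; have := trial_minimizer k Kk (x k); rewrite !reg_modelE.
by move: (phi_neqNy (xhat k)); case: (phi (xhat k)) => [r| |] //; case: (phi (x k)).
Qed.

Lemma iterate_fin_num k : phi (x k) \is a fin_num.
Proof.
elim: k => [|k IH]; first exact/fin_num_edom/(run_x0 run).
have [sk|/step_unsuccessful[-> _ _]] // := lem (succ k).
have [-> _ _] := step_successful k sk.
by apply: trial_fin_num => //; case: sk.
Qed.

Lemma iterate_domain k : O (x k).
Proof. exact/dom_phi_O/edom_fin_num/iterate_fin_num. Qed.

Lemma trial_domain k : K k -> O (xhat k).
Proof.
by move=> Kk; apply/dom_phi_O/edom_fin_num/trial_fin_num => //; exact: iterate_fin_num.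
Qed.

Lemma hessian_sym k : (B k)^T = B k.
Proof.
elim: k => [|k IH]; first exact: run_B0 run.
by have [/step_successful[]|/step_unsuccessful[_ -> _]] := lem (succ k).
Qed.

Lemma mu_ge_mumin k : mumin <= mu k.
Proof.
elim: k => [|k IH]; first by have /andP[] := run_mu0 run.
have [/step_successful[_ _ /andP[]]|/step_unsuccessful[_ _ ->]] // := lem (succ k).
by rewrite (le_trans IH) // ler_peMl ?(ltW sigma2_gt1) ?(le_trans (ltW mumin_gt0) IH).
Qed.

Lemma mu_gt0 k : 0 < mu k.
Proof. exact: lt_le_trans mumin_gt0 (mu_ge_mumin k). Qed.

(** The value of the objective at the iterates, as a real number. *)
Definition value k : R := f (x k) + fine (phi (x k)).

Lemma valueE k : objective f phi (x k) = (value k)%:E.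
Proof. by rewrite /objective -(fineK (iterate_fin_num k)) -EFinD. Qed.

(** The reductions are real numbers; minimality of the trial point bounds the
    predicted one below, and their difference is the error of the quadratic
    model of [f]. *)
Lemma reductions k : K k -> exists P A : R,
  [/\ pred_red f phi x B xhat k = P%:E, ared f phi x xhat k = A%:E,
      mu k / 2 * enorm (d k) ^+ 2 <= P,
      P - A = f (xhat k) - f (x k) - dotv (grad f (x k)) (d k)
              - 2^-1 * dotv (d k) (B k *m d k)
    & objective f phi (xhat k) = (value k - A)%:E].
Proof.
move=> Kk; have := trial_minimizer k Kk (x k); rewrite !reg_modelE.
rewrite quad_model_center /pred_red /ared /model valueE /objective /value.
have := trial_fin_num k Kk (iterate_fin_num k).
case: (phi (xhat k)) => [ph| |] // _; have := iterate_fin_num k.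
case: (phi (x k)) => [p| |] //= _; rewrite -!EFinD lee_fin /quad_model.
move: (dotv (grad f (x k)) (d k)) (dotv (d k) (B k *m d k)) (enorm (d k) ^+ 2)
  (f (xhat k)) (f (x k)) (mu k / 2) => g q t fh fx m le_m.
exists (fx + p - (fx + g + 2^-1 * q + ph)), (fx + p - (fh + ph)); split.
- by [].
- by [].
- by lra.
- by ring.
- by congr (_%:E); ring.
Qed.

(** Sufficient decrease. *)
Lemma successful_decrease k : succ k ->
  c1 * (mu k / 2 * enorm (d k) ^+ 2) <= value k - value k.+1.
Proof.
move=> sk; have [Kk] := sk; have [P [A [-> -> muP _ xhA]]] := reductions k Kk.
rewrite -EFinM lee_fin => PA.
have -> : value k.+1 = value k - A.
  have [xk _ _] := step_successful k sk.
  by apply: EFin_inj; rewrite -valueE -xhA xk.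
by rewrite subKr; apply: le_trans PA; rewrite ler_pM2l.
Qed.

Lemma value_unsuccessful k : ~ succ k -> value k.+1 = value k.
Proof. by move=> /step_unsuccessful[xk _ _]; rewrite /value xk. Qed.

Lemma value_nonincreasing k m : (k <= m)%N -> value m <= value k.
Proof.
move=> /subnK <-; elim: (m - k)%N => // j IH; rewrite addSn; apply: le_trans IH.
have [sk|/value_unsuccessful ->] // := lem (succ (j + k)%N).
rewrite -subr_ge0; apply: le_trans (successful_decrease _ sk).
apply: mulr_ge0; first exact: ltW.
by rewrite mulr_ge0 ?sqr_ge0 // divr_ge0 // ltW // mu_gt0.
Qed.

(** At an unsuccessful iteration the error of the quadratic model of [f] is a
    fixed fraction of the predicted reduction. *)
Lemma unsuccessful_model_error k : K k -> ~ succ k ->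
  (1 - c1) * (mu k / 2 * enorm (d k) ^+ 2) <=
    f (xhat k) - f (x k) - dotv (grad f (x k)) (d k)
      - 2^-1 * dotv (d k) (B k *m d k).
Proof.
move=> Kk nsk; have [P [A [PE AE muP <- _]]] := reductions k Kk.
have AP : A < c1 * P.
  rewrite ltNge; apply/negP => le_A; apply: nsk; split => //.
  by rewrite PE AE -EFinM lee_fin.
have : (1 - c1) * (mu k / 2 * enorm (d k) ^+ 2) <= (1 - c1) * P.
  by rewrite ler_pM2l // subr_gt0.
by lra.
Qed.

(** The residual left by Fermat's rule bounds the stationarity measure. *)
Lemma edist_trial_le k : K k ->
  (edist_to 0 (limiting_subdiff (objective f phi) (xhat k)) <=
    (enorm (grad f (xhat k) - grad f (x k)) + (MB + mu k) * enorm (d k))%:E)%E.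
Proof.
move=> Kk; have muk := mu_gt0 k.
have hatfin := trial_fin_num k Kk (iterate_fin_num k).
have := minimizer_regular_subdiff _ _ _ _ _ _ _ (hessian_sym k) (ltW MB_gt0)
  (B_bounded k) (ltW muk) phi_neqNy hatfin (f_diff _ (trial_domain k Kk))
  (trial_minimizer k Kk).
move=> /regular_sub_limiting_subdiff /edist_to0_le /le_trans; apply.
rewrite lee_fin; apply: le_trans (enormD _ _) _; rewrite lerD2l enormN mulrDl.
apply: le_trans (enormD _ _) _; rewrite enormZ (gtr0_norm muk) lerD2r.
by apply: ler_enorm_mulmx => //; exact: ltW.
Qed.

Context (O_open : open O).
Context (phi_lsc : lower_semicontinuous phi) (phi_prox : prox_bounded phi).
Context (F_lsc : lower_semicontinuous (objective f phi)).
Context (F_bounded : (-oo < ereal_inf (range (objective f phi)))%E).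
Context (found : minimizers_found f phi x B mu K).
Context (grad_unif : unif_continuous_on O (grad f)).

Lemma value_cauchy (e : R) : 0 < e -> exists N, forall k m,
  (N <= k)%N -> (k <= m)%N -> value k - value m < e.
Proof.
move=> e0; have [l lP] : exists l : R, forall k, l <= value k.
  have infle k : (ereal_inf (range (objective f phi)) <= (value k)%:E)%E.
    by apply: ereal_inf_lbound; exists (x k); rewrite ?valueE.
  move: F_bounded infle; case: (ereal_inf _) => [r| |] // _ infle; last first.
    by have := infle 0%N.
  by exists r => k; rewrite -lee_fin.
have hinf : has_inf (range value).
  by split; [exists (value 0%N), 0%N|exists l => _ [k _ <-]].
have [_ [N _ <-] Ne] := inf_adherent e0 hinf.
exists N => k m Nk _; have := value_nonincreasing _ _ Nk.
have : inf (range value) <= value m by apply: ge_inf; [case: hinf|exists m].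
by lra.
Qed.

Lemma successful_steps_vanish (e : R) : 0 < e -> exists N, forall k,
  (N <= k)%N -> succ k -> enorm (d k) < e.
Proof.
move=> e0; have C0 : 0 < c1 * (mumin / 2) by rewrite mulr_gt0 // divr_gt0.
have [|N NP] := value_cauchy (c1 * (mumin / 2) * e ^+ 2).
  by rewrite mulr_gt0 // exprn_gt0.
exists N => k Nk sk; have := successful_decrease k sk.
have := NP k k.+1 Nk (leqnSn k) => h1 h2.
have h3 : c1 * (mumin / 2) * enorm (d k) ^+ 2 <= c1 * (mu k / 2 * enorm (d k) ^+ 2).
  rewrite -mulrA ler_pM2l // ler_wpM2r ?sqr_ge0 // ler_pM2r ?invr_gt0 //.
  exact: mu_ge_mumin.
have := le_lt_trans h3 (le_lt_trans h2 h1); rewrite ltr_pM2l //.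
by rewrite ltr_pXn2r // nnegrE ?enorm_ge0 // ltW.
Qed.

(** * Runs that stay away from stationarity *)

Section Nonstationary.
(* The hypothesis [stay] is refuted at the end of the section. *)
Context (eps : R) (N0 : nat) (eps_gt0 : 0 < eps).
Context (stay : forall k, K k -> (N0 <= k)%N ->
  (eps%:E <= edist_to 0 (limiting_subdiff (objective f phi) (xhat k)))%E).

Lemma residual_ge k : K k -> (N0 <= k)%N ->
  eps <= enorm (grad f (xhat k) - grad f (x k)) + (MB + mu k) * enorm (d k).
Proof.
by move=> Kk Nk; rewrite -lee_fin; apply: le_trans (stay k Kk Nk) (edist_trial_le k Kk).
Qed.

Lemma successful_mu_step_ge : exists N, forall k, (N <= k)%N -> succ k ->
  eps / 4 <= mu k * enorm (d k).
Proof.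
have e2 : 0 < eps / 2 by rewrite divr_gt0.
have [dl dl0 dlP] := grad_unif _ e2.
have [|N NP] := successful_steps_vanish (Num.min dl (eps / (4 * MB))).
  by rewrite lt_min dl0 divr_gt0 // mulr_gt0.
exists (maxn N0 N) => k; rewrite geq_max => /andP[N0k Nk] sk.
have Kk : K k by case: sk.
have := NP k Nk sk; rewrite lt_min => /andP[d1 d2].
have := dlP _ _ (trial_domain k Kk) (iterate_domain k) d1.
have := residual_ge k Kk N0k.
rewrite ltr_pdivlMr ?mulr_gt0 // in d2.
by rewrite mulrDl; lra.
Qed.

(** While the trial points stay away from stationarity, the sufficient decrease
    [c1 * mu k / 2 * enorm (d k) ^+ 2] dominates the length of the step, so that
    the iterates inherit the Cauchy property of their values. *)
Lemma step_le_decrease : exists (C : R) N, 0 < C /\ forall k m, (N <= k)%N ->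
  (k <= m)%N -> enorm (x m - x k) <= C * (value k - value m).
Proof.
have [N NP] := successful_mu_step_ge.
(* A successful step of length [t] decreases the objective by at least
   [c1 / 2 * (mu k * t) * t >= c1 / 2 * (eps / 4) * t]. *)
exists (8 / (c1 * eps)), N; split; first by rewrite divr_gt0 // mulr_gt0.
move=> k m Nk /subnK <-; elim: (m - k)%N => [|j IH].
  by rewrite add0n !subrr enorm0 mulr0.
rewrite addSn; set i := (j + k)%N in IH *.
apply: le_trans (enorm_triangle (x i) _ _) _.
suff : enorm (x i.+1 - x i) <= 8 / (c1 * eps) * (value i - value i.+1).
  by move: IH; lra.
have [si|nsi] := lem (succ i); last first.
  have [-> _ _] := step_unsuccessful i nsi.
  by rewrite (value_unsuccessful i nsi) !subrr enorm0 mulr0.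
have [-> _ _] := step_successful i si.
have Ni : (N <= i)%N by rewrite (leq_trans Nk) // leq_addl.
rewrite mulrAC ler_pdivlMr ?mulr_gt0 //.
have := successful_decrease i si; have := NP i Ni si.
have := enorm_ge0 (d i); move: (enorm (d i)) => t t0 h1 h2.
have : c1 * (eps / 4 * t) <= c1 * (mu i * t * t).
  by rewrite ler_pM2l // ler_wpM2r.
by lra.
Qed.

Lemma iterates_converge : exists p, forall e : R, 0 < e ->
  exists N, forall k, (N <= k)%N -> enorm (x k - p) < e.
Proof.
have [C [N [C0 NP]]] := step_le_decrease.
have cau (e : R) : 0 < e -> exists2 M, (N <= M)%N &
    forall k m, (M <= k)%N -> (k <= m)%N -> enorm (x m - x k) < e.
  move=> e0; have [|M MP] := value_cauchy (e / C); first by rewrite divr_gt0.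
  exists (maxn N M); first exact: leq_maxl.
  move=> k m; rewrite geq_max => /andP[Nk Mk] km.
  apply: le_lt_trans (NP k m Nk km) _.
  by have := MP k m Mk km; rewrite ltr_pdivlMr // mulrC.
have [M1 _ M1P] := cau 1 ltr01.
have [p pP] : exists p, forall e, 0 < e -> forall N', exists2 k, (N' <= k)%N &
    enorm (x (k + M1)%N - p) < e.
  apply: (bounded_seq_cluster (fun k => x (k + M1)%N) (1 + enorm (x M1))) => k.
  have := M1P M1 (k + M1)%N (leqnn _) (leq_addl _ _).
  have := enormD (x (k + M1)%N - x M1) (x M1); rewrite subrK; lra.
exists p => e e0; have e2 : 0 < e / 2 by rewrite divr_gt0.
have [M _ MP] := cau _ e2; exists M => k Mk.
have [j kj jp] := pP _ e2 k.
have := MP k (j + M1)%N Mk (leq_trans kj (leq_addr _ _)).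
have := enorm_triangle (x (j + M1)%N) (x k) p.
by rewrite (enorm_distC (x k) (x _)); lra.
Qed.

(** The values [F (x k)] are bounded above, hence so is [F p]. *)
Lemma limit_domain p :
  (forall e : R, 0 < e -> exists N, forall k, (N <= k)%N -> enorm (x k - p) < e) ->
  O p.
Proof.
move=> xp; apply: dom_phi_O; rewrite /edom /= ltNge; apply/negP => phip.
have [|V /nbhs_enormP[r r0 rV] VP] := F_lsc p (value 0%N).
  by move: phip; rewrite leye_eq /objective => /eqP ->; rewrite addey ?ltey.
have [N NP] := xp _ r0; have := VP _ (rV _ (NP N (leqnn N))).
by rewrite valueE lte_fin ltNge value_nonincreasing.
Qed.

(** Otherwise all late parameters would be bounded. By
    [successful_mu_step_ge] the successful steps would then be bounded away
    from 0, hence would cease, and the parameters would grow geometrically. *)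
Lemma unsuccessful_large_mu (M : R) (N : nat) :
  exists k, [/\ (N <= k)%N, ~ succ k & M <= mu k].
Proof.
apply: contrapT => none; pose M' := Num.max mumax (sigma2 * M).
have bound k : (N <= k)%N -> mu k.+1 <= M'.
  move=> Nk; have [/step_successful[_ _ /andP[_ h]]|nsk] := lem (succ k).
    by rewrite le_max h.
  have [_ _ ->] := step_unsuccessful k nsk.
  rewrite le_max ler_pM2l ?(lt_trans ltr01) //; apply/orP; right.
  by rewrite leNgt; apply/negP => Mk; apply: none; exists k; split => //; exact: ltW.
have M'0 : 0 < M' by apply: lt_le_trans (bound N (leqnn N)); exact: mu_gt0.
have [N1 N1P] := successful_mu_step_ge.
have [|N2 N2P] := successful_steps_vanish (eps / (4 * M')).
  by rewrite divr_gt0 // mulr_gt0.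
pose m := (maxn N.+1 (maxn N1 N2)).
have nosucc k : (m <= k)%N -> ~ succ k.
  rewrite !geq_max => /andP[Nk /andP[N1k N2k]] sk.
  have := N2P k N2k sk; rewrite ltr_pdivlMr ?mulr_gt0 // => h1.
  have := N1P k N1k sk; have : mu k <= M' by case: k Nk {sk N1k N2k h1} => // k /bound.
  have := enorm_ge0 (d k); move: (enorm (d k)) h1 => t h1 t0 h2 h3.
  have : mu k * t <= M' * t by rewrite ler_wpM2r.
  by lra.
have grow j : mu (m + j)%N = sigma2 ^+ j * mu m.
  elim: j => [|j IH]; first by rewrite addn0 expr0 mul1r.
  have [_ _] := step_unsuccessful _ (nosucc (m + j)%N (leq_addr _ _)).
  by rewrite addnS => ->; rewrite IH exprS mulrA.
have s0 : 0 < sigma2 - 1 by rewrite subr_gt0.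
(* Bernoulli's inequality. *)
have bern j : 1 + (sigma2 - 1) *+ j <= sigma2 ^+ j.
  elim: j => [|j IH]; first by rewrite mulr0n addr0 expr0.
  rewrite exprS mulrS; have : 0 <= (sigma2 - 1) *+ j by rewrite mulrn_wge0 // ltW.
  move: ((sigma2 - 1) *+ j) (sigma2 ^+ j) IH => u w IH u0; nra.
have [j Mj] : exists j, M' / mu m < (sigma2 - 1) *+ j.
  exists (Num.bound (M' / mu m / (sigma2 - 1))).
  rewrite -mulr_natr -ltr_pdivrMl // mulrC.
  by apply: archi_boundP; rewrite !divr_ge0 // ltW // mu_gt0.
have Nm : (N <= m + j)%N.
  exact: leq_trans (leqnSn N) (leq_trans (leq_maxl _ _) (leq_addr _ _)).
have := bound _ Nm; rewrite -addnS grow.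
apply/negP; rewrite -ltNge -ltr_pdivrMr ?mu_gt0 //; apply: lt_le_trans Mj _.
apply: le_trans (bern _); rewrite mulrS; lra.
Qed.

(** Near [p] the bounds of [reg_model_minorant] are uniform in [k], so that a
    large [mu k] ensures that a trial point exists and is close to [x k]. *)
Lemma large_mu_step_small p (e : R) : 0 < e ->
  (forall r : R, 0 < r -> exists N, forall k, (N <= k)%N -> enorm (x k - p) < r) ->
  exists (M : R) N, forall k, (N <= k)%N -> M <= mu k -> K k /\ enorm (d k) < e.
Proof.
move=> e0 xp; have Op := limit_domain p xp.
have [a [c [xbar [a0 phiP]]]] := prox_bounded_minorant _ phi_prox.
have [r1 r10 r1P] := differentiable_continuous_enorm _ _ _ (f_diff _ Op) ltr01.
have [r2 r20 r2P] := grad_unif _ ltr01.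
have [|N NP] := xp (Num.min 1 (Num.min r1 r2)); first by rewrite !lt_min ltr01 r10.
pose L := enorm (grad f p) + 1.
pose D := value 0%N - f p + 1 - c + 2 * a * (enorm (p - xbar) + 1) ^+ 2.
have L0 : 0 <= L by rewrite addr_ge0 // enorm_ge0.
have [M MP] := quadratic_le_small (MB / 2 + 2 * a) L D e e0 L0.
exists (Num.max M (MB + 4 * a + 1)), N => k Nk; rewrite ge_max => /andP[Mk Mk'].
have Kk : K k.
  apply: found; apply: (reg_model_has_minimizer _ _ _ _ _ _ _ _ xbar
    (hessian_sym k) (ltW MB_gt0) (B_bounded k) a0 phiP phi_lsc (iterate_fin_num k)).
  by lra.
split=> //; apply: (MP _ _ Mk (enorm_ge0 _)).
have := NP k Nk; rewrite !lt_min => /andP[xk1 /andP[xkr1 xkr2]].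
have := trial_minimizer k Kk (x k).
have -> : reg_model f phi (x k) (B k) (mu k) (x k) = (value k)%:E.
  by rewrite reg_modelE quad_model_center -valueE.
have := reg_model_minorant f phi (x k) (B k) (mu k) MB a c xbar (xhat k)
  (ltW MB_gt0) (B_bounded k) a0 phiP.
move=> /le_trans h /h {h}; rewrite lee_fin.
have h1 : value k <= value 0%N by exact: value_nonincreasing.
have h2 : f p - 1 <= f (x k) by have := r1P _ xkr1; rewrite ltr_norml => /andP[]; lra.
have h3 : enorm (grad f (x k)) * enorm (d k) <= L * enorm (d k).
  rewrite ler_wpM2r ?enorm_ge0 //.
  rewrite -[leLHS](congr1 enorm (subrK (grad f p) (grad f (x k)))).
  apply: le_trans (enormD _ _) _; rewrite addrC lerD2l.
  exact: ltW (r2P _ _ (iterate_domain k) Op xkr2).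
have h4 : a * enorm (x k - xbar) ^+ 2 <= a * (enorm (p - xbar) + 1) ^+ 2.
  rewrite ler_wpM2l // ler_pXn2r ?nnegrE ?addr_ge0 ?enorm_ge0 //.
  have := enorm_triangle p (x k) xbar; lra.
by move: h1 h2 h3 h4; rewrite /D; move: (enorm (d k) ^+ 2) => T; lra.
Qed.

Lemma not_nonstationary : False.
Proof.
have [p xp] := iterates_converge; have Op := limit_domain p xp.
have c10 : 0 < 1 - c1 by rewrite subr_gt0.
(* The tolerance required by [residual_lt]. *)
pose eta := eps * (1 - c1) / 8.
have eta0 : 0 < eta by rewrite divr_gt0 // mulr_gt0.
have [dl dl0 dlP] := grad_unif _ eta0.
have [r r0 rO] : exists2 r, 0 < r & forall y, enorm (y - p) < r -> O y.
  by apply/nbhs_enormP; exact: open_nbhs_nbhs.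
have r2 : 0 < r / 2 by rewrite divr_gt0.
have [|M [N NP]] := large_mu_step_small p (Num.min (eta / MB) (Num.min dl (r / 2))) _ xp.
  by rewrite !lt_min dl0 r2 divr_gt0.
have [N' N'P] := xp _ r2.
have [k [Nk nsk Mk]] := unsuccessful_large_mu M (maxn N0 (maxn N N')).
move: Nk; rewrite !geq_max => /andP[N0k /andP[Nk N'k]].
have [Kk] := NP k Nk Mk; rewrite !lt_min => /andP[dMB /andP[ddl dr]].
have xkr := N'P k N'k.
(* The segment from the iterate to the trial point stays in the ball. *)
have seg (t : R) : 0 <= t <= 1 -> O (x k + t *: d k) /\ enorm (t *: d k) <= enorm (d k).
  move=> /andP[t0 t1]; have td : enorm (t *: d k) <= enorm (d k).
    by rewrite enormZ ger0_norm // ler_piMl // enorm_ge0.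
  split=> //; apply: rO; rewrite addrAC.
  by have := enormD (x k - p) (t *: d k); lra.
have [t t01] := @segment_MVT R n f (x k) (d k) (fun t t01 => f_diff _ (seg t t01).1).
rewrite (addrC (x k) (d k)) subrK => fE.
have [Ot td] := seg t t01.
have gt_small : enorm (grad f (x k + t *: d k) - grad f (x k)) < eta.
  by apply: dlP => //; [exact: iterate_domain|rewrite addrC addKr (le_lt_trans td)].
have := unsuccessful_model_error k Kk nsk; rewrite fE -dotvBl => herr.
have h1 := ler_dotv (grad f (x k + t *: d k) - grad f (x k)) (d k).
have := ler_norm_dotv_mulmx (B k) MB (d k) (ltW MB_gt0) (B_bounded k).
rewrite ler_norml => /andP[h2 _].
have h3 := residual_ge k Kk N0k.
have h4 := dlP _ _ (trial_domain k Kk) (iterate_domain k) ddl.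
rewrite ltr_pdivlMr // mulrC in dMB.
have := residual_lt _ _ _ _ _ _ _ _ _ eps_gt0 c1_gt0 c1_lt1 (enorm_ge0 (d k))
  dMB h4 gt_small herr h1 h2.
by rewrite ltNge h3.
Qed.

End Nonstationary.
End AlgorithmRun.

Theorem theorem3p11 (R : realType) (n : nat)
  (f : 'cV[R]_n -> R) (phi : 'cV[R]_n -> \bar R) (O : set 'cV[R]_n)
  (c1 sigma2 mumin mumax : R)
  (x : nat -> 'cV[R]_n) (B : nat -> 'M[R]_n) (mu : nat -> R)
  (K : set nat) (xhat : nat -> 'cV[R]_n) (MB : R)
  (phi_neqNy : forall y, phi y != -oo%E)
  (F_proper : proper_efun (objective f phi))
  (F_lsc : lower_semicontinuous (objective f phi))
  (c1_gt0 : 0 < c1) (c1_lt1 : c1 < 1) (sigma2_gt1 : 1 < sigma2)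
  (mumin_gt0 : 0 < mumin) (mumin_le_mumax : mumin <= mumax)
  (O_open : open O) (dom_phi_O : edom phi `<=` O) (f_C1 : C1_on O f)
  (phi_proper : proper_efun phi) (phi_lsc : lower_semicontinuous phi)
  (phi_prox : prox_bounded phi)
  (F_bounded : (-oo < ereal_inf (range (objective f phi)))%E)
  (run : algorithm_run f phi c1 sigma2 mumin mumax x B mu K xhat)
  (found : minimizers_found f phi x B mu K)
  (MB_gt0 : 0 < MB) (B_bounded : forall k, (opnorm (B k) <= MB%:E)%E)
  (grad_unif : unif_continuous_on O (grad f)) :
  limf_einf (fun k => edist_to 0 (limiting_subdiff (objective f phi) (xhat k)))
    (within K \oo) = 0%E.
Proof.
apply/eqP; rewrite limf_einfE eq_le; apply/andP; split; last first.
  apply: le_trans (ereal_sup_ubound _); last first.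
    by exists setT; [exact: filterT|reflexivity].
  by apply: le_ereal_inf_tmp => _ [k _ <-]; exact: edist_to_ge0.
apply: ge_ereal_sup => _ [V [N0 _ KV] <-]; rewrite leNgt; apply/negP => inf_gt0.
have [eps eps_gt0 eps_le] : exists2 eps : R, 0 < eps & (eps%:E <= ereal_inf
    [set edist_to 0 (limiting_subdiff (objective f phi) (xhat k)) | k in V])%E.
  case: (ereal_inf _) inf_gt0 => [r| |] //; first by rewrite lte_fin; exists r.
  by exists 1; rewrite ?leey.
apply: (not_nonstationary f phi O c1 sigma2 mumin mumax x B mu K xhat MB
  phi_neqNy c1_gt0 c1_lt1 sigma2_gt1 mumin_gt0 dom_phi_O f_C1.1 run MB_gt0
  B_bounded O_open phi_lsc phi_prox F_lsc F_bounded found grad_unif eps N0 eps_gt0).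
move=> k Kk N0k; apply: le_trans eps_le _; apply: ereal_inf_lbound.
by exists k => //; exact: KV.
Qed.
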